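(* Let $S$ be a subring of a finite ring $R$. Then \[ \Pr(S,R)\ge \frac{1}{|[S,R]|}\left(1+\frac{|[S,R]|-1}{|S:Z(S,R)|}\right). \] In particular, if $Z(S,R)\ne S$ then $\Pr(S,R)>\dfrac{1}{|[S,R]|}$.
   Context: Rings are associative and are not required to have an identity; a subring is an additive subgroup closed under multiplication. For a subring $S$ of a finite ring $R$: $[S,R]$ is the subgroup of $(R,+)$ generated by all additive commutators $[s,r]=sr-rs$ with $s\in S$, $r\in R$; $Z(S,R)=\{s\in S: sr=rs \text{ for all } r\in R\}$; $|S:Z(S,R)|$ is the index of the additive subgroup $Z(S,R)$ in $(S,+)$; and $\Pr(S,R)=\dfrac{|\{(s,r)\in S\times R: sr=rs\}|}{|S|\,|R|}$. *)

(* Defs.v *)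
From HB Require Import structures.
From mathcomp Require Import all_boot all_order all_algebra all_fingroup.

Set Implicit Arguments.
Unset Strict Implicit.
Unset Printing Implicit Defensive.

Import GRing.Theory.
Local Open Scope ring_scope.

(* MathComp's ring structures all have a unit; a rng is an associative ring   *)
(* with no identity assumed. The magma operation of monoid.v is not reused:   *)
(* finalg.v already uses it for the addition of a finZmodType.                *)
HB.mixin Record Zmodule_isRng R of GRing.Zmodule R := {
  rmul : R -> R -> R;
  rmulA : associative rmul;
  rmulDl : left_distributive rmul +%R;
  rmulDr : right_distributive rmul +%R
}.

#[short(type="finRngType")]
HB.structure Definition FinRng := {R of Zmodule_isRng R & FinRing.Zmodule R}.

Notation "x ** y" := (rmul x y) (at level 40, left associativity) : ring_scope.

(* As in finalg.v: %g notations on R refer to the additive group (R, +).      *)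
#[non_forgetful_inheritance]
HB.instance Definition _ (R : finRngType) := [finGroupMixin of R for +%R].
Coercion FinRng_to_baseFinGroup (R : finRngType) := FinStarMonoid.clone R _.
Coercion FinRng_to_finGroup (R : finRngType) := FinGroup.clone R _.

Section RelativeCommutativity.

Variable R : finRngType.
Implicit Type S : {set R}.

Definition is_subring S : Prop :=
  zmod_closed S /\ {in S &, forall x y, x ** y \in S}.

Definition rng_commutator (s r : R) : R := s ** r - r ** s.

Definition commutator_subgroup S : {set R} :=
  <<[set rng_commutator s r | s in S, r in [set: R]]>>%g.

Definition relative_center S : {set R} :=
  [set s in S | [forall r, s ** r == r ** s]].

Definition commuting_prob S : rat :=
  #|[set p in setX S [set: R] | p.1 ** p.2 == p.2 ** p.1]|%:R
    / (#|S|%:R * #|R|%:R).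

End RelativeCommutativity.

(* Main.v *)
Require Import Defs.
From HB Require Import structures.
From mathcomp Require Import all_boot all_order all_algebra all_fingroup.
From mathcomp Require Import ring.
Set Implicit Arguments.
Unset Strict Implicit.
Unset Printing Implicit Defensive.
Import Order.TTheory GRing.Theory Num.Theory.
Local Open Scope ring_scope.

(** Counting commuting pairs one row at a time gives
    Pr(S, R) |S| |R| = sum over s in S of |C_R(s)|.  For s in S, the map
    r |-> [s, r] is an endomorphism of (R, +) with kernel C_R(s) and image
    inside K = [S, R], so |R| <= |C_R(s)| |K| ([card_le_centralizer_commutator]);
    and for s in Z = Z(S, R) the centralizer is all of R.  Summing the two
    estimates over Z and over S \ Z gives
    |K| |Z| |R| + |S \ Z| |R| <= |K| sum |C_R(s)| ([card_commuting_pairs_ge]),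
    which is the stated inequality after dividing by |K| |S| |R| and writing
    |S| = |Z| |S : Z|.  If Z <> S, some commutator is nonzero, so |K| > 1 and
    the correction term (|K| - 1) / |S : Z| is positive. *)

Section CommutingPairs.

Variables (R : finRngType) (S : {set R}).
Implicit Types s r : R.

Definition rng_centralizer s : {set R} := [set r | s ** r == r ** s].

Lemma rng_commutatorD s r1 r2 :
  rng_commutator s (r1 + r2) = rng_commutator s r1 + rng_commutator s r2.
Proof. by rewrite /rng_commutator rmulDr rmulDl opprD addrACA. Qed.

(** The first isomorphism theorem for the additive map r |-> [s, r], whose
    kernel is the centralizer of s: |R| = |C_R(s)| |[s, R]|, and [s, R] is a
    subset of K. *)
Lemma card_le_centralizer_commutator s :
  s \in S -> (#|R| <= #|rng_centralizer s| * #|commutator_subgroup S|)%N.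
Proof.
move=> sS.
have fM : {in [set: R] &, {morph rng_commutator s : x y / (x * y)%g}}.
  by move=> x y _ _; apply: rng_commutatorD.
pose f := Morphism fM.
have kerE : ('ker f)%g = rng_centralizer s.
  by apply/setP => r; rewrite !inE /= -[RHS]subr_eq0.
have imS : (f @* [set: R])%g \subset commutator_subgroup S.
  apply/subsetP => _ /morphimP[r _ _ ->]; apply: mem_gen.
  by apply: imset2_f; rewrite ?inE.
have := Lagrange (subsetT ('ker f)%G); have := card_morphim f [set: R].
rewrite setIid => <- /=; rewrite kerE cardsT => <-.
by rewrite leq_mul2l subset_leq_card ?orbT.
Qed.

Lemma card_centralizer_center s : s \in relative_center S -> #|rng_centralizer s| = #|R|.
Proof.
rewrite inE => /andP[_ /forallP sZ].
by rewrite -cardsT; apply: eq_card => r; rewrite !inE sZ.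
Qed.

Lemma card_commuting_pairs :
  #|[set p in setX S [set: R] | p.1 ** p.2 == p.2 ** p.1]|
    = (\sum_(s in S) #|rng_centralizer s|)%N.
Proof.
under [RHS]eq_bigr do rewrite -sum1_card.
rewrite pair_big_dep /= -sum1_card; apply: eq_bigl => -[s r].
by rewrite !inE andbT.
Qed.

Lemma relative_center_sub : relative_center S \subset S.
Proof. by apply/subsetP => s; rewrite inE => /andP[]. Qed.

(** The sum over s in S of |K| |C_R(s)| is split into Z and S \ Z: each term is
    exactly |K| |R| on Z and at least |R| elsewhere. *)
Lemma card_commuting_pairs_ge :
  (#|commutator_subgroup S| * #|relative_center S| * #|R|
     + (#|S| - #|relative_center S|) * #|R|
   <= #|commutator_subgroup S|
        * #|[set p in setX S [set: R] | p.1 ** p.2 == p.2 ** p.1]|)%N.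
Proof.
rewrite card_commuting_pairs (big_setID (relative_center S)) /= mulnDr.
rewrite (setIidPr relative_center_sub) -cardsDS ?relative_center_sub //.
rewrite leq_add //.
  by rewrite (eq_bigr _ card_centralizer_center) sum_nat_const mulnA.
rewrite -sum_nat_const big_distrr /= leq_sum // => s /setDP[sS _].
by rewrite mulnC card_le_centralizer_commutator.
Qed.

(** Lagrange's theorem for the additive groups of Z(S, R) and S; it applies once
    both are shown to be subgroups of (R, +), where finiteness makes closure
    under addition enough. *)
Lemma card_relative_center_index :
  is_subring S ->
  (#|relative_center S| * #|S : relative_center S|%g)%N = #|S|.
Proof.
move=> [[S0 SB] _].
have SD : {in S &, forall x y, x + y \in S}.
  by move=> x y xS yS; rewrite -[y]opprK SB // -sub0r SB.
have gS : group_set S by apply/group_setP.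
have rmul0r r : 0 ** r = 0 by apply: (addrI (0 ** r)); rewrite -rmulDl !addr0.
have rmulr0 r : r ** 0 = 0 by apply: (addrI (r ** 0)); rewrite -rmulDr !addr0.
have gZ : group_set (relative_center S).
  apply/group_setP; split=> [|x y].
    by rewrite inE S0; apply/forallP => r; rewrite rmul0r rmulr0.
  rewrite !inE => /andP[xS /forallP xZ] /andP[yS /forallP yZ].
  rewrite SD //; apply/forallP => r.
  by rewrite rmulDl rmulDr (eqP (xZ r)) (eqP (yZ r)).
exact: (@Lagrange _ (Group gS) (Group gZ) relative_center_sub).
Qed.

Lemma commutator_subgroup_nontrivial :
  relative_center S <> S -> (1 < #|commutator_subgroup S|)%N.
Proof.
move=> ZS; rewrite cardG_gt1; apply: contra_notN ZS => /eqP K1.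
apply/eqP; rewrite eqEsubset relative_center_sub /=.
apply/subsetP => s sS; rewrite inE sS; apply/forallP => r.
have: rng_commutator s r \in commutator_subgroup S.
  by apply/mem_gen/imset2_f.
by rewrite /commutator_subgroup K1 inE /rng_commutator subr_eq0.
Qed.

End CommutingPairs.

Theorem theorem2p17 (R : finRngType) (S : {set R}) (subringS : is_subring S) :
  let K := commutator_subgroup S in
  let Z := relative_center S in
  commuting_prob S >=
    1 / #|K|%:R * (1 + (#|K|%:R - 1) / #|S : Z|%g%:R)
  /\ (Z <> S -> commuting_prob S > 1 / #|K|%:R).
Proof.
move=> K Z.
have K0 : (0 < #|K|)%N by apply: cardG_gt0.
have R0 : (0 < #|R|)%N by apply/card_gt0P; exists 0.
have S0 : (0 < #|S|)%N by apply/card_gt0P; exists 0; case: subringS => -[].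
have cardS := card_relative_center_index subringS; rewrite -/Z in cardS.
have [Z0 i0] : (0 < #|Z|)%N /\ (0 < #|S : Z|%g)%N.
  by apply/andP; rewrite -muln_gt0 cardS.
have bound : 1 / #|K|%:R * (1 + (#|K|%:R - 1) / #|S : Z|%g%:R)
    <= commuting_prob S.
  have := card_commuting_pairs_ge S.
  rewrite -(ler_nat rat) natrD !natrM natrB ?subset_leq_card ?relative_center_sub //.
  rewrite /commuting_prob -/K -/Z -cardS natrM => le.
  rewrite ler_pdivlMr ?mulr_gt0 ?ltr0n // -(ler_pM2l (_ : 0 < #|K|%:R)) ?ltr0n //.
  (* With |S| = |Z| |S : Z|, the integer bound is exactly the claimed one
     multiplied by |K| |S| |R|. *)
  apply: le_trans le; rewrite le_eqVlt; apply/orP; left; apply/eqP.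
  by field; rewrite !pnatr_eq0 -!lt0n K0 i0.
split=> // ZS; apply: lt_le_trans bound.
rewrite -[ltLHS]mulr1 ltr_pM2l ?divr_gt0 ?ltr0n // ltrDl divr_gt0 ?ltr0n //.
by rewrite subr_gt0 ltr1n commutator_subgroup_nontrivial.
Qed.
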